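(* Let $k\ge2$ be an integer, $\varepsilon\in(0,1]$, $\gamma>\frac12$, and assume $$\tau\lesssim\min\bigl\{\varepsilon^{1+\sigma_0},\ N^{-(1+\sigma_0)}\bigr\}$$ for some fixed $\sigma_0>0$ (which may be arbitrarily small). For $w\in Y_N$ let $\psi_w:Y_N\to Y_N$ be $$\psi_w(\phi)=\bigl(\mathcal A^+_{\tau,\varepsilon}\bigr)^{-1}\mathcal A^-_{\tau,\varepsilon}w-\frac\tau k\bigl(\mathcal A^+_{\tau,\varepsilon}\bigr)^{-1}\partial_xP_N\Bigl(\bigl(\tfrac{w+\phi}2\bigr)^k\Bigr),\qquad \mathcal A^\pm_{\tau,\varepsilon}=I\pm\tfrac12\varepsilon^2\tau\partial_x^3 .$$ Then the following hold. (i) For any $\phi_1,\phi_2\in Y_N$ there exist $\sigma>0$ (depending on $\sigma_0$) and a constant $C(\|w\|_{H^\gamma},\|\phi_1\|_{H^\gamma},\|\phi_2\|_{H^\gamma})$ such that $$\|\psi_w(\phi_1)-\psi_w(\phi_2)\|_{H^\gamma}\le C\bigl(\|w\|_{H^\gamma},\|\phi_1\|_{H^\gamma},\|\phi_2\|_{H^\gamma}\bigr)\,\tau^\sigma\,\|\phi_1-\phi_2\|_{H^\gamma}.$$ (ii) Given any $M>0$ with $\|w\|_{H^\gamma}\le M$, there exists $\tau_M>0$ such that for all $\tau<\tau_M$ the mapping $\psi_w$ admits a unique fixed point $\phi^*\in B_{2M}$, i.e. $\phi^*=\psi_w(\phi^* )$.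
   Context: $\mathbb T=(-\pi,\pi)$ with periodic boundary conditions; $\tau>0$; $N$ is an even positive integer. Fourier coefficients: $\widehat u(\xi)=\frac1{2\pi}\int_{\mathbb T}u(x)e^{-\mathrm i\xi(x+\pi)}\,dx$. Norm: $\|u\|_{H^\gamma}=\bigl(\sum_{\xi\in\mathbb Z}(1+\xi^2)^\gamma|\widehat u(\xi)|^2\bigr)^{1/2}$. $Y_N=\operatorname{span}\{e^{\mathrm i\xi(x+\pi)}:\xi=-\frac N2,\dots,\frac N2\}$, $P_N:L^2(\mathbb T)\to Y_N$ is the orthogonal projection $P_Nu=\sum_{\xi=-N/2}^{N/2}\widehat u(\xi)e^{\mathrm i\xi(x+\pi)}$, and $B_R=\{\phi\in Y_N:\|\phi\|_{H^\gamma}\le R\}$. $A\lesssim B$ means $|A|\le C_0B$ for some constant $C_0>0$ independent of $\varepsilon,\tau,N$. The constants $C(\cdot,\cdot,\cdot)$, $\sigma$ and $\tau_M$ are independent of $\varepsilon$, $\tau$ and $N$ (with $k$, $\gamma$, $\sigma_0$ and the constant implied in the step-size condition regarded as fixed). *)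

(* Defs.v *)
From HB Require Import structures.
From mathcomp Require Export all_boot all_order all_algebra.
From mathcomp Require Export all_classical all_reals all_analysis.
From mathcomp.real_closed Require Export complex.
Export Order.TTheory GRing.Theory Num.Theory.
Export numFieldNormedType.Exports.

Set Implicit Arguments.
Unset Strict Implicit.
Unset Printing Implicit Defensive.

Local Open Scope classical_set_scope.
Local Open Scope ring_scope.
Local Open Scope complex_scope.

(* Functions on the torus are represented by functions R -> R[i]; every element
   of [trig_space N] is 2pi-periodic and determined by its values on (-pi, pi). *)

Definition cis {R : realType} (t : R) : R[i] := cos t +i* sin t.

Definition expmode {R : realType} (xi : int) (x : R) : R[i] :=
  cis (xi%:~R * (x + pi)).

Definition cintegral {R : realType} (D : set R) (f : R -> R[i]) : R[i] :=
  Rintegral lebesgue_measure D (fun x => complex.Re (f x)) +i*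
  Rintegral lebesgue_measure D (fun x => complex.Im (f x)).

Definition fourier {R : realType} (u : R -> R[i]) (xi : int) : R[i] :=
  ((2 * pi)^-1)%:C *
  cintegral `]-pi, pi[ (fun x => u x * cis (- (xi%:~R * (x + pi)))).

(* The sum takes values in [0, +oo], so [sobolev_norm gamma u] is the H^gamma
   norm of u when u belongs to H^gamma (in particular for every trigonometric
   polynomial), and 0 when the series diverges. *)
Definition sobolev_norm {R : realType} (gamma : R) (u : R -> R[i]) : R :=
  Num.sqrt (fine (\esum_(xi in [set: int])
    ((1 + (xi%:~R : R) ^+ 2) `^ gamma *
     ComplexField.Normc.normc (fourier u xi) ^+ 2)%:E)).

(* The frequencies -N/2, ..., N/2, for N even. *)
Definition freq (N : nat) (j : 'I_N.+1) : int := j%:Z - (N./2)%:Z.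

Definition trig_space {R : realType} (N : nat) : set (R -> R[i]) :=
  [set u | exists c : 'I_N.+1 -> R[i],
     u = fun x => \sum_(j < N.+1) c j * expmode (freq j) x].

Definition trig_proj {R : realType} (N : nat) (u : R -> R[i]) : R -> R[i] :=
  fun x => \sum_(j < N.+1) fourier u (freq j) * expmode (freq j) x.

Definition dx {R : realType} (u : R -> R[i]) : R -> R[i] :=
  fun x => @Complex R (derive1 (fun y => complex.Re (u y)) x)
                      (derive1 (fun y => complex.Im (u y)) x).

Definition opAp {R : realType} (tau eps : R) (u : R -> R[i]) : R -> R[i] :=
  fun x => u x + (2^-1 * eps ^+ 2 * tau)%:C * iter 3 dx u x.

Definition opAm {R : realType} (tau eps : R) (u : R -> R[i]) : R -> R[i] :=
  fun x => u x - (2^-1 * eps ^+ 2 * tau)%:C * iter 3 dx u x.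

(* The inverse of A^+ as an operator on Y_N: the element of Y_N that A^+ maps
   to u, for u in A^+(Y_N) = Y_N. *)
Definition opAp_inv {R : realType} (N : nat) (tau eps : R) :
    (R -> R[i]) -> (R -> R[i]) :=
  'pinv_(fun=> fun=> 0) (trig_space N) (opAp tau eps).

Definition psi {R : realType} (k N : nat) (tau eps : R) (w phi : R -> R[i]) :
    R -> R[i] :=
  fun x =>
    opAp_inv N tau eps (opAm tau eps w) x
    - (tau / k%:R)%:C *
      opAp_inv N tau eps
        (dx (trig_proj N (fun y => ((w y + phi y) / 2) ^+ k))) x.

Definition trig_ball {R : realType} (N : nat) (gamma r : R) : set (R -> R[i]) :=
  [set phi | trig_space N phi /\ sobolev_norm gamma phi <= r].

(* Main.v *)
Require Import Defs.
From mathcomp Require Import ring lra zify.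

Set Implicit Arguments.
Unset Strict Implicit.
Unset Printing Implicit Defensive.

Local Open Scope classical_set_scope.
Local Open Scope ring_scope.
Local Open Scope complex_scope.

(* With z = exp (i (x + pi)), an element of Y_N is z^(-N/2) p(z) for a polynomial p of size
   at most N + 1, so products of trigonometric polynomials are products of polynomials, and
   on coefficients the operators are Fourier multipliers. Since (A+)^(-1) A- is unitary and
   the multiplier of (A+)^(-1) dx is bounded by |xi| <= N, the map psi_w is
   (tau N) L-Lipschitz, where L comes from the algebra property of H^gamma, gamma > 1/2;
   the step-size condition gives tau N <= C tau^(sigma0 / (1 + sigma0)). Finally
   psi_w (- w) = (A+)^(-1) A- w has the same norm as w, so for small tau psi_w is a
   contraction of the ball of radius 2M. *)

(** * Weighted norms of coefficient sequences *)

Definition sqn {R : realType} (z : R[i]) : R := ComplexField.Normc.normc z ^+ 2.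

Section SquaredModulus.
Variable R : realType.
Implicit Types z w : R[i].

Lemma sqnE z : sqn z = complex.Re z ^+ 2 + complex.Im z ^+ 2.
Proof. by case: z => a b; rewrite /sqn /= sqr_sqrtr ?addr_ge0 ?sqr_ge0. Qed.

Lemma sqn_ge0 z : 0 <= sqn z.
Proof. exact: sqr_ge0. Qed.

Lemma sqnM z w : sqn (z * w) = sqn z * sqn w.
Proof. by rewrite /sqn ComplexField.Normc.normcM exprMn. Qed.

Lemma sqn0 : sqn (0 : R[i]) = 0.
Proof. by rewrite sqnE /= expr0n addr0. Qed.

Lemma sqn_real (a : R) : sqn a%:C = a ^+ 2.
Proof. by rewrite sqnE /= expr0n addr0. Qed.

Lemma sqnN z : sqn (- z) = sqn z.
Proof. by case: z => a b; rewrite !sqnE /= !sqrrN. Qed.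

Lemma sqn_eq0 z : (sqn z == 0) = (z == 0).
Proof.
case: z => a b; rewrite sqnE /= paddr_eq0 ?sqr_ge0 // !sqrf_eq0.
by rewrite eq_complex.
Qed.

Lemma sqnD z w : sqn (z + w) <= 2 * (sqn z + sqn w).
Proof.
case: z => a b; case: w => c d; rewrite !sqnE /=.
have := sqr_ge0 (a - c); have := sqr_ge0 (b - d); nra.
Qed.

(** Cauchy-Schwarz for two terms, freed of square roots: the cross term is at most 2 sqrt (s t S T),
    hence at most s T + S t by the arithmetic-geometric mean inequality. *)
Lemma sqnD_weighted z w (s t S T : R) : 0 <= s -> 0 <= t -> 0 <= S -> 0 <= T ->
  sqn z <= s * t -> sqn w <= S * T -> sqn (z + w) <= (s + S) * (t + T).
Proof.
case: z => a b; case: w => c d s0 t0 S0 T0; rewrite !sqnE /= => hz hw.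
have sT : 0 <= s * T by rewrite mulr_ge0.
have St : 0 <= S * t by rewrite mulr_ge0.
have cross : 2 * (a * c + b * d) <= s * T + S * t.
  rewrite leNgt; apply/negP => lt.
  have : (s * T + S * t) ^+ 2 < (2 * (a * c + b * d)) ^+ 2.
    by rewrite ltr_pXn2r ?nnegrE //; lra.
  have : (a ^+ 2 + b ^+ 2) * (c ^+ 2 + d ^+ 2) <= (s * t) * (S * T).
    by apply: ler_pM => //; rewrite addr_ge0 ?sqr_ge0.
  have := sqr_ge0 (a * d - b * c); have := sqr_ge0 (s * T - S * t).
  nra.
nra.
Qed.

(** Weighted Cauchy-Schwarz; in the product estimate [s] collects inverse weights and [t] the
    weighted squared moduli. *)
Lemma sqn_sum (I : Type) (r : seq I) (F : I -> R[i]) (s t : I -> R) :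
  (forall i, 0 <= s i) -> (forall i, 0 <= t i) ->
  (forall i, sqn (F i) <= s i * t i) ->
  sqn (\sum_(i <- r) F i) <= (\sum_(i <- r) s i) * (\sum_(i <- r) t i).
Proof.
move=> s0 t0 h; elim: r => [|i r IH]; first by rewrite !big_nil sqn0 mul0r.
by rewrite !big_cons; apply: sqnD_weighted => //; apply: sumr_ge0.
Qed.

End SquaredModulus.

Definition weight {R : realType} (gamma : R) (xi : int) : R :=
  (1 + (xi%:~R : R) ^+ 2) `^ gamma.

(* The squared H^gamma norm of z^(-n) p(z), z = exp (i (x + pi)). *)
Definition hnorm {R : realType} (gamma : R) (n : nat) (p : {poly R[i]}) : R :=
  \sum_(i < size p) weight gamma (i%:Z - n%:Z) * sqn p`_i.

Section Hnorm.
Variables (R : realType) (gamma : R).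
Implicit Types p q : {poly R[i]}.

Lemma weight_gt0 xi : 0 < weight gamma xi.
Proof. by rewrite powR_gt0 // ltr_pwDl // sqr_ge0. Qed.

Lemma weight_ge1 xi : 0 <= gamma -> 1 <= weight gamma xi.
Proof.
move=> g0; rewrite -(powRr0 (1 + (xi%:~R : R) ^+ 2)).
by apply: ler_powR => //; rewrite lerDl sqr_ge0.
Qed.

Lemma hnorm_wide n p L : (size p <= L)%N ->
  hnorm gamma n p = \sum_(i < L) weight gamma (i%:Z - n%:Z) * sqn p`_i.
Proof.
move=> sL; rewrite /hnorm (big_ord_widen _ (fun i => weight gamma (i%:Z - n%:Z) * sqn p`_i) sL).
rewrite [RHS](bigID (fun i : 'I_L => (i < size p)%N)) /= [X in _ = _ + X]big1 ?addr0 //.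
by move=> i; rewrite -leqNgt => /(nth_default 0) ->; rewrite sqn0 mulr0.
Qed.

Lemma hnorm_ge0 n p : 0 <= hnorm gamma n p.
Proof.
by apply: sumr_ge0 => i _; rewrite mulr_ge0 ?sqn_ge0 // ltW ?weight_gt0.
Qed.

Lemma hnorm_term_le n p i : weight gamma (i%:Z - n%:Z) * sqn p`_i <= hnorm gamma n p.
Proof.
rewrite (@hnorm_wide n p (maxn (size p) i.+1)) ?leq_maxl //.
have iL : (i < maxn (size p) i.+1)%N by rewrite leq_max ltnSn orbT.
rewrite (bigD1 (Ordinal iL)) //= lerDl sumr_ge0 // => j _.
by rewrite mulr_ge0 ?sqn_ge0 // ltW ?weight_gt0.
Qed.

Lemma hnorm_coef_le n p i : 0 <= gamma -> sqn p`_i <= hnorm gamma n p.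
Proof.
move=> g0; apply: le_trans (hnorm_term_le n p i).
by rewrite ler_peMl ?sqn_ge0 ?weight_ge1.
Qed.

Lemma hnorm_eq0 n p : hnorm gamma n p = 0 -> p = 0.
Proof.
move=> h; apply/polyP => i; rewrite coef0; apply/eqP.
have := hnorm_term_le n p i; rewrite h pmulr_rle0 ?weight_gt0 // => h0.
by rewrite -sqn_eq0 eq_le h0 sqn_ge0.
Qed.

Lemma hnorm_le_coef n p q (c : R) : (forall i, sqn q`_i <= c * sqn p`_i) ->
  hnorm gamma n q <= c * hnorm gamma n p.
Proof.
move=> h; rewrite (@hnorm_wide n q (maxn (size p) (size q))) ?leq_maxr //.
rewrite (@hnorm_wide n p (maxn (size p) (size q))) ?leq_maxl //.
rewrite mulr_sumr; apply: ler_sum => i _.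
by rewrite [leRHS]mulrCA ler_wpM2l // ltW ?weight_gt0.
Qed.

Lemma hnormN n p : hnorm gamma n (- p) = hnorm gamma n p.
Proof. by rewrite /hnorm size_polyN; apply: eq_bigr => i _; rewrite coefN sqnN. Qed.

Lemma hnormD n p q : hnorm gamma n (p + q) <= 2 * (hnorm gamma n p + hnorm gamma n q).
Proof.
set L := maxn (size p) (size q).
rewrite (@hnorm_wide n p L) ?leq_maxl // (@hnorm_wide n q L) ?leq_maxr //.
rewrite (@hnorm_wide n _ L) ?size_polyD // -big_split mulr_sumr /=.
apply: ler_sum => i _; rewrite coefD -mulrDr [leRHS]mulrCA.
by rewrite ler_wpM2l ?sqnD // ltW ?weight_gt0.
Qed.

Lemma hnormZ n p c : hnorm gamma n (c *: p) <= sqn c * hnorm gamma n p.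
Proof. by apply: hnorm_le_coef => i; rewrite coefZ sqnM. Qed.

Lemma hnorm1 : hnorm gamma 0 1 = 1.
Proof.
rewrite /hnorm size_poly1 big_ord1 subrr /weight expr0n addr0 powR1 mul1r coef1 eqxx.
by rewrite /sqn ComplexField.Normc.normc1 expr1n.
Qed.

(* Peetre-type inequality: (a + b)^2 + 1 <= 4 max (1 + a^2, 1 + b^2). *)
Lemma weightD (xi eta : int) : 0 <= gamma ->
  weight gamma (xi + eta) <= 4 `^ gamma * (weight gamma xi + weight gamma eta).
Proof.
move=> g0; rewrite /weight; set a : R := xi%:~R; set b : R := eta%:~R.
have -> : (xi + eta)%:~R = a + b :> R by rewrite rmorphD.
wlog ab : a b / a ^+ 2 <= b ^+ 2.
  move=> H; have [/H //|/ltW/H] := leP (a ^+ 2) (b ^+ 2).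
  by rewrite (addrC b) (addrC ((1 + b ^+ 2) `^ gamma)).
have h : 1 + (a + b) ^+ 2 <= 4 * (1 + b ^+ 2).
  by have := sqr_ge0 (a - b); nra.
apply: (@le_trans _ _ ((4 * (1 + b ^+ 2)) `^ gamma)).
  apply: ge0_ler_powR => //; rewrite nnegrE; last by rewrite mulr_ge0 ?addr_ge0 ?sqr_ge0.
  by rewrite addr_ge0 ?sqr_ge0.
rewrite powRM ?addr_ge0 ?sqr_ge0 // ler_wpM2l ?powR_ge0 // lerDr powR_ge0 //.
Qed.

(** Uniformity in both the length [L] and the offset [n] is what makes the later constants
    independent of N. *)
Definition inv_weight_bound (S : R) := forall L n : nat,
  \sum_(i < L) (weight gamma (i%:Z - n%:Z))^-1 <= S.

(** Cauchy-Schwarz on each coefficient of the convolution leaves the sum of weight (xi + eta) /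
    (weight xi * weight eta), which [weightD] reduces to two sums of inverse weights. *)
Lemma hnormM S n m p q : 0 <= gamma -> inv_weight_bound S ->
  hnorm gamma (n + m) (p * q) <=
  (4 `^ gamma * (S + S)) * (hnorm gamma n p * hnorm gamma m q).
Proof.
move=> g0 hS.
(* The weighted squared moduli become the coefficients of a real polynomial whose value at 1 is
   [hnorm]; a product of norms is then the value at 1 of a product, compared coefficient by
   coefficient. *)
pose W (n : nat) (p : {poly R[i]}) : {poly R} :=
  \poly_(i < size p) (weight gamma (i%:Z - n%:Z) * sqn p`_i).
have WE k (r : {poly R[i]}) i : (W k r)`_i = weight gamma (i%:Z - k%:Z) * sqn r`_i.
  by rewrite coef_poly; case: ltnP => // /(nth_default 0) ->; rewrite sqn0 mulr0.
have hW k (r : {poly R[i]}) : hnorm gamma k r = (W k r).[1].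
  rewrite (@horner_coef_wide _ (size r)) ?size_poly //; apply: eq_bigr => i _.
  by rewrite expr1n mulr1 WE.
have W0 k (r : {poly R[i]}) i : 0 <= (W k r)`_i.
  by rewrite WE mulr_ge0 ?sqn_ge0 // ltW ?weight_gt0.
set L := maxn (size (p * q)) (size (W n p * W m q)).
rewrite (@hnorm_wide _ _ L) ?leq_maxl // !hW -hornerM.
rewrite (@horner_coef_wide _ L (W n p * W m q)) ?leq_maxr // mulr_sumr.
apply: ler_sum => i _; rewrite expr1n mulr1 !coefM.
have w0 := weight_gt0.
pose s (j : 'I_i.+1) : R :=
  (weight gamma (j%:Z - n%:Z))^-1 * (weight gamma ((i - j)%N%:Z - m%:Z))^-1.
pose t (j : 'I_i.+1) : R := (W n p)`_j * (W m q)`_(i - j).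
have s0 j : 0 <= s j by rewrite mulr_ge0 ?invr_ge0 // ltW.
have t0 j : 0 <= t j by rewrite mulr_ge0.
have st (j : 'I_i.+1) : sqn (p`_j * q`_(i - j)) <= s j * t j.
  rewrite sqnM /s /t !WE le_eqVlt; apply/orP; left; apply/eqP.
  by field; rewrite !gt_eqF ?w0.
apply: le_trans (ler_wpM2l (ltW (w0 _)) (sqn_sum _ s0 t0 st)) _.
rewrite mulrA ler_wpM2r ?sumr_ge0 // mulr_sumr.
apply: (@le_trans _ _ (\sum_(j < i.+1) 4 `^ gamma * ((weight gamma (j%:Z - n%:Z))^-1 +
    (weight gamma ((i - j)%N%:Z - m%:Z))^-1))).
  apply: ler_sum => j _; rewrite /s.
  have -> : i%:Z - (n + m)%N%:Z = (j%:Z - n%:Z) + ((i - j)%N%:Z - m%:Z).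
    by have := ltn_ord j; lia.
  set a := j%:Z - _; set b := _ - m%:Z.
  have -> : (weight gamma a)^-1 + (weight gamma b)^-1 =
     (weight gamma a + weight gamma b) * ((weight gamma a)^-1 * (weight gamma b)^-1).
    by field; rewrite !gt_eqF ?w0.
  rewrite mulrA ler_wpM2r ?weightD // mulr_ge0 ?invr_ge0 // ltW //.
rewrite -mulr_sumr ler_wpM2l ?powR_ge0 // big_split lerD ?hS //.
rewrite (reindex_inj rev_ord_inj) /=.
apply: le_trans (hS i.+1 m); apply: ler_sum => j _.
by rewrite subSS subKn // -ltnS.
Qed.

(** Induction on p^(k+1) - q^(k+1) = p (p^k - q^k) + (p - q) q^k. Both terms obey the same bound,
    and [hnormD] doubles their sum because norms are squared: hence the 4 per step. *)
Lemma hnorm_exp_diff K n p q a k : 1 <= K -> 1 <= a ->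
  (forall n m p q, hnorm gamma (n + m) (p * q) <= K * (hnorm gamma n p * hnorm gamma m q)) ->
  hnorm gamma n p <= a -> hnorm gamma n q <= a ->
  hnorm gamma (k * n) (p ^+ k - q ^+ k) <= (4 * K * a) ^+ k * hnorm gamma n (p - q).
Proof.
move=> K1 a1 hM hp hq.
have K0 : 0 <= K by lra.
have a0 : 0 <= a by lra.
have hqk j : hnorm gamma (j * n) (q ^+ j) <= (K * a) ^+ j.
  elim: j => [|j IH]; first by rewrite mul0n !expr0 hnorm1.
  rewrite mulSn !exprS; apply: le_trans (hM _ _ _ _) _.
  by rewrite -mulrA ler_wpM2l //; apply: ler_pM; rewrite ?hnorm_ge0.
elim: k => [|k IH].
  by rewrite !expr0 subrr mul1r /hnorm size_poly0 big_ord0 hnorm_ge0.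
have -> : p ^+ k.+1 - q ^+ k.+1 = p * (p ^+ k - q ^+ k) + (p - q) * q ^+ k.
  by rewrite !exprS; ring.
rewrite mulSn; apply: le_trans (hnormD _ _ _) _.
have D0 := hnorm_ge0 n (p - q).
have X0 : 0 <= (4 * K * a) ^+ k * hnorm gamma n (p - q).
  by rewrite mulr_ge0 ?exprn_ge0 ?mulr_ge0.
have h1 : hnorm gamma (n + k * n) (p * (p ^+ k - q ^+ k)) <=
    K * (a * ((4 * K * a) ^+ k * hnorm gamma n (p - q))).
  by apply: le_trans (hM _ _ _ _) _; rewrite ler_wpM2l //; apply: ler_pM; rewrite ?hnorm_ge0.
have h2 : hnorm gamma (n + k * n) ((p - q) * q ^+ k) <=
    K * (a * ((4 * K * a) ^+ k * hnorm gamma n (p - q))).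
  apply: le_trans (hM _ _ _ _) _; rewrite ler_wpM2l //.
  apply: (@le_trans _ _ ((4 * K * a) ^+ k * hnorm gamma n (p - q))); last first.
    by rewrite ler_peMl.
  rewrite mulrC ler_wpM2r //; apply: le_trans (hqk k) _.
  rewrite lerXn2r ?nnegrE ?mulr_ge0 // -mulrA ler_peMl ?mulr_ge0 //; lra.
rewrite exprS; lra.
Qed.

End Hnorm.

(** * Summability of the inverse weights and the algebra property of H^gamma *)

Section WeightSum.
Variables (R : realType) (gamma : R).
Hypothesis gamma_gt : 2^-1 < gamma.

Let gamma_ge0 : 0 <= gamma. Proof. by have := gamma_gt; lra. Qed.
(** Here rho = 4^gamma bounds the growth of the weight from one dyadic block to the next; gamma >
    1/2 says exactly rho > 2, so the ratio 2 / rho is below 1. *)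
Let rho : R := 2 `^ (2 * gamma).
Let rho_gt2 : 2 < rho.
Proof.
have ln2 : 0 < ln 2 :> R by rewrite ln_gt0 // ltr1n.
rewrite /rho /powR pnatr_eq0 /= -[X in X < _]lnK ?posrE // ltr_expR.
by rewrite ltr_pMl //; have := gamma_gt; lra.
Qed.

Lemma weight_pow2_ge m (i : nat) : (2 ^ m <= i)%N -> rho ^+ m <= weight gamma i%:Z.
Proof.
move=> hi; have -> : rho ^+ m = ((2 ^+ m) ^+ 2) `^ gamma.
  rewrite /rho -(powR_mulrn m (powR_ge0 _ _)) -powRrM -exprM -powR_mulrn // -powRrM.
  by congr (_ `^ _); rewrite natrM; ring.
apply: ge0_ler_powR => //; rewrite ?nnegrE ?addr_ge0 ?sqr_ge0 //.
apply: (@le_trans _ _ ((i%:R : R) ^+ 2)); last by rewrite lerDr.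
by rewrite lerXn2r ?nnegrE ?exprn_ge0 // -natrX ler_nat.
Qed.

(* Dyadic blocks: the block [2^m, 2^(m+1)) contributes at most (2 / 4^gamma)^m. *)
Lemma weight_sum_pow2 m : \sum_(i < 2 ^ m) (weight gamma i%:Z)^-1 <=
  1 + (1 - (2 / rho) ^+ m) / (1 - 2 / rho).
Proof.
have r1 : 2 / rho < 1 by rewrite ltr_pdivrMr ?mul1r //; have := rho_gt2; lra.
elim: m => [|m IH].
  rewrite big_ord1 expr0 subrr mul0r addr0 /weight expr0n addr0 powR1 invr1 //.
have sE : (2 ^ m.+1 = 2 ^ m + 2 ^ m)%N by rewrite expnS; lia.
rewrite sE big_split_ord /=.
have h : \sum_(i < 2 ^ m) (weight gamma (2 ^ m + i)%N%:Z)^-1 <= (2 / rho) ^+ m.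
  apply: (@le_trans _ _ (\sum_(i < 2 ^ m) (rho ^+ m)^-1)).
    apply: ler_sum => i _; rewrite lef_pV2 ?posrE ?weight_gt0 ?exprn_gt0 //;
      last by have := rho_gt2; lra.
    by apply: weight_pow2_ge; rewrite leq_addr.
  by rewrite sumr_const card_ord -[leLHS]mulr_natl natrX exprMn exprVn.
apply: le_trans (lerD IH h) _; rewrite le_eqVlt; apply/orP; left; apply/eqP.
by rewrite exprS; field; have := rho_gt2; lra.
Qed.

Lemma weight_sum_bound n : \sum_(i < n) (weight gamma i%:Z)^-1 <= 1 + (1 - 2 / rho)^-1.
Proof.
have r1 : 2 / rho < 1 by rewrite ltr_pdivrMr ?mul1r //; have := rho_gt2; lra.
have r0 : 0 <= 2 / rho by rewrite divr_ge0 //; have := rho_gt2; lra.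
(* Since n < 2^n, enlarging the range reduces to the dyadic bound. *)
apply: (@le_trans _ _ (\sum_(i < 2 ^ n) (weight gamma i%:Z)^-1)).
  rewrite (big_ord_widen _ (fun i => (weight gamma i%:Z)^-1) (ltnW (ltn_expl n (ltnSn 1)))).
  rewrite [leRHS](bigID (fun i : 'I_(2 ^ n) => (i < n)%N)) /= lerDl.
  by rewrite sumr_ge0 // => i _; rewrite invr_ge0 ltW ?weight_gt0.
apply: le_trans (weight_sum_pow2 n) _; rewrite lerD2l ler_pdivrMr ?subr_gt0 //.
by rewrite mulVf ?gerBl ?exprn_ge0 // gt_eqF ?subr_gt0.
Qed.

Lemma weightN (xi : int) : weight gamma (- xi) = weight gamma xi.
Proof. by rewrite /weight rmorphN sqrrN. Qed.

(** The frequencies i - n are split at 0; evenness of the weight folds the negative ones onto the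
    positive ones, so the one-sided bound is paid twice. *)
Lemma inv_weight_boundP : exists S, 0 < S /\ inv_weight_bound gamma S.
Proof.
set S := 1 + (1 - 2 / rho)^-1; exists (S + S).
have hS := weight_sum_bound.
have w0 := weight_gt0 gamma.
have S0 : 0 < S.
  by apply: lt_le_trans (hS 1%N); rewrite big_ord1 invr_gt0.
split; first by rewrite addr_gt0.
move=> L n.
apply: (@le_trans _ _ (\sum_(i < n + L) (weight gamma (i%:Z - n%:Z))^-1)).
  rewrite (big_ord_widen _ (fun i => (weight gamma (i%:Z - n%:Z))^-1) (leq_addl n L)).
  rewrite [leRHS](bigID (fun i : 'I_(n + L) => (i < L)%N)) /= lerDl.
  by rewrite sumr_ge0 // => i _; rewrite invr_ge0 ltW.
rewrite big_split_ord lerD //=.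
  rewrite (reindex_inj rev_ord_inj) /=.
  (* Reversal maps the frequencies -n, ..., -1 to 1, ..., n; the bound for [n.+1] terms also
     contains the frequency 0, whose nonnegative term is added. *)
  apply: le_trans (hS n.+1); rewrite big_ord_recl /=.
  rewrite -[leLHS]add0r lerD // ?invr_ge0 ?(ltW (w0 _)) //.
  apply: ler_sum => i _; rewrite (_ : _ - _ = - (i.+1%:Z)); last by have := ltn_ord i; lia.
  by rewrite weightN.
apply: le_trans (hS L); apply: ler_sum => i _.
by rewrite (_ : _ - _ = i%:Z) //; lia.
Qed.

Lemma hnorm_algebra : exists2 K : R, 1 <= K &
  forall n m p q, hnorm gamma (n + m) (p * q) <= K * (hnorm gamma n p * hnorm gamma m q).
Proof.
have [S [S0 hS]] := inv_weight_boundP.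
(* The summand 1 ensures K >= 1. *)
exists (1 + 4 `^ gamma * (S + S)).
  by rewrite lerDl mulr_ge0 ?powR_ge0 //; lra.
move=> n m p q; apply: le_trans (hnormM n m p q gamma_ge0 hS) _.
by rewrite ler_wpM2r ?mulr_ge0 ?hnorm_ge0 // lerDr.
Qed.

End WeightSum.

(** * Fourier analysis of trigonometric polynomials *)

Section Modes.
Variable R : realType.
Implicit Types (f g : R -> R[i]) (c : R[i]) (xi eta : int).

Lemma cisD (a b : R) : cis (a + b) = cis a * cis b.
Proof. by rewrite /cis sinD cosD; apply/eqP; rewrite eq_complex /= addrC eqxx addrC eqxx. Qed.

Lemma expmodeD xi eta (x : R) : expmode (xi + eta) x = expmode xi x * expmode eta x.
Proof. by rewrite /expmode rmorphD mulrDl cisD. Qed.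

Lemma expmode0 (x : R) : expmode 0 x = 1.
Proof. by rewrite /expmode mul0r /cis cos0 sin0. Qed.

Lemma expmode_nat (i : nat) (x : R) : expmode i%:Z x = expmode 1 x ^+ i.
Proof.
elim: i => [|i IH]; first by rewrite expmode0.
by rewrite exprS -IH -expmodeD; congr expmode; lia.
Qed.

Lemma sin_2pi_int xi : sin (xi%:~R * (pi + pi)) = 0 :> R.
Proof.
suff h (n : nat) : sin (n%:R * (pi + pi)) = 0 :> R.
  case: xi => n; first exact: h.
  by rewrite NegzE rmorphN mulNr sinN h oppr0.
have := periodicn (@sinD2pi R) n 0; rewrite add0r sin0 => <-.
by congr sin; rewrite -mulr2n mulr_natl.
Qed.

Lemma cos_2pi_int xi : cos (xi%:~R * (pi + pi)) = 1 :> R.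
Proof.
suff h (n : nat) : cos (n%:R * (pi + pi)) = 1 :> R.
  case: xi => n; first exact: h.
  by rewrite NegzE rmorphN mulNr cosN h.
have := periodicn (@cosD2pi R) n 0; rewrite add0r cos0 => cos_period; rewrite -[RHS]cos_period.
by congr cos; rewrite -mulr2n mulr_natl.
Qed.

Let mu := @lebesgue_measure R.
Let T : set R := `](- pi), pi[.

Lemma continuous_segment_integrable (f : R -> R) : continuous f ->
  mu.-integrable `[(- pi), pi] (EFin \o f).
Proof.
move=> cf; apply: continuous_compact_integrable; first exact: segment_compact.
exact: continuous_subspaceT.
Qed.

Lemma is_derive_continuous (F f : R -> R) :
  (forall x : R, is_derive x 1 F (f x)) -> continuous F.
Proof.
by move=> dF x; apply: differentiable_continuous; apply/derivable1_diffP; case: (dF x).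
Qed.

Lemma Rintegral_torus_derive (f F : R -> R) : continuous f ->
  (forall x : R, is_derive x 1 F (f x)) ->
  Rintegral mu T f = F pi - F (- pi).
Proof.
move=> cf dF.
have cF := is_derive_continuous dF.
have pi_lt : - pi < pi :> R by have := pi_gt0 R; lra.
(* The fundamental theorem of calculus is applied on the closed interval; adding the endpoints does
   not change the integral. *)
have int_f := continuous_segment_integrable cf.
rewrite /T Rintegral_itv_bndo_bndc; last first.
  by apply: integrableS int_f => //; apply: subset_itv_oo_cc.
rewrite Rintegral_itv_obnd_cbnd; last first.
  by apply: integrableS int_f => //; apply: subset_itv_oc_cc.
rewrite /Rintegral (@continuous_FTC2 _ f F) //.
- exact: continuous_subspaceT.
- split.
  + by move=> x _; case: (dF x).
  + by apply: cvg_at_right_filter; apply: cF.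
  + by apply: cvg_at_left_filter; apply: cF.
- by move=> x _; rewrite derive1E; case: (dF x).
Qed.


Definition cderiv f x (d : R[i]) :=
  is_derive x (1 : R) (fun y => complex.Re (f y)) (complex.Re d) /\
  is_derive x (1 : R) (fun y => complex.Im (f y)) (complex.Im d).

Lemma ReD (z w : R[i]) : complex.Re (z + w) = complex.Re z + complex.Re w.
Proof. by case: z; case: w. Qed.

Lemma ImD (z w : R[i]) : complex.Im (z + w) = complex.Im z + complex.Im w.
Proof. by case: z; case: w. Qed.

Lemma dx_cderiv f f' : (forall x, cderiv f x (f' x)) -> dx f = f'.
Proof.
move=> h; apply/funext => x; rewrite /dx !derive1E.
by have [[_ ->] [_ ->]] := h x; case: (f' x).
Qed.

Lemma cderiv_sum (I : Type) (r : seq I) (f : I -> R -> R[i]) x (d : I -> R[i]) :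
  (forall i, cderiv (f i) x (d i)) ->
  cderiv (fun y => \sum_(i <- r) f i y) x (\sum_(i <- r) d i).
Proof.
move=> h; elim: r => [|i r [IH1 IH2]].
  rewrite /cderiv big_nil /=; under eq_fun do rewrite big_nil.
  by under [X in _ /\ is_derive _ _ X _]eq_fun do rewrite big_nil; split; apply: is_derive_cst.
have [h1 h2] := h i.
rewrite /cderiv big_cons; split.
  rewrite ReD (_ : (fun y => _) = (fun y => complex.Re (f i y)) +
    (fun y => complex.Re (\sum_(j <- r) f j y))); first exact: is_deriveD.
  by apply/funext => y; rewrite big_cons ReD.
rewrite ImD (_ : (fun y => _) = (fun y => complex.Im (f i y)) +
    (fun y => complex.Im (\sum_(j <- r) f j y))); first exact: is_deriveD.
by apply/funext => y; rewrite big_cons ImD.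
Qed.

Lemma cderivZ c f x d : cderiv f x d -> cderiv (fun y => c * f y) x (c * d).
Proof.
case: c d => a b [c d] [/= h1 h2]; split => /=.
- rewrite (_ : (fun y => _) = a *: (fun y => complex.Re (f y)) - b *: (fun y => complex.Im (f y))).
    exact: is_deriveB.
  by apply/funext => y; rewrite !fctE; case: (f y).
- rewrite (_ : (fun y => _) = a *: (fun y => complex.Im (f y)) + b *: (fun y => complex.Re (f y))).
    exact: is_deriveD.
  by apply/funext => y; rewrite !fctE; case: (f y).
Qed.

Lemma cderiv_expmode xi x :
  cderiv (expmode xi) x (0 +i* xi%:~R * expmode xi x).
Proof.
have dphase : is_derive x (1 : R) (fun y : R => xi%:~R * (y + pi)) (xi%:~R : R).
  rewrite (_ : (fun y => _) = (xi%:~R : R) *: (id + cst pi)) //.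
  by apply: is_derive_eq; rewrite addr0 scaler1.
split => /=.
- have h := @is_derive1_comp _ cos _ x _ _ (is_derive_cos _) dphase.
  by apply: is_derive_eq; rewrite mul0r sub0r mulNr mulrC.
- have h := @is_derive1_comp _ sin _ x _ _ (is_derive_sin _) dphase.
  by apply: is_derive_eq; rewrite mul0r add0r mulrC.
Qed.

Lemma cderiv_phase x : cderiv (fun y => (y + pi)%:C) x 1.
Proof.
split => /=; last exact: is_derive_cst.
rewrite (_ : (fun y => _) = id + cst pi) //.
by apply: is_derive_eq; rewrite addr0.
Qed.

(** The derivative [f'] supplies the continuity of [f] that the fundamental theorem of calculus
    requires. *)
Lemma cintegral_cderiv (f f' F : R -> R[i]) : (forall x, cderiv f x (f' x)) ->
  (forall x, cderiv F x (f x)) -> cintegral T f = F pi - F (- pi).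
Proof.
move=> df dF.
have eRe : Rintegral mu T (fun x => complex.Re (f x)) = complex.Re (F pi) - complex.Re (F (- pi)).
  apply: (@Rintegral_torus_derive _ (fun x => complex.Re (F x))) => [|x]; last by case: (dF x).
  by apply: (@is_derive_continuous _ (fun x => complex.Re (f' x))) => x; case: (df x).
have eIm : Rintegral mu T (fun x => complex.Im (f x)) = complex.Im (F pi) - complex.Im (F (- pi)).
  apply: (@Rintegral_torus_derive _ (fun x => complex.Im (F x))) => [|x]; last by case: (dF x).
  by apply: (@is_derive_continuous _ (fun x => complex.Im (f' x))) => x; case: (df x).
by rewrite /cintegral eRe eIm; case: (F pi); case: (F (- pi)).
Qed.

Lemma cintegral_modes (I : Type) (r : seq I) (c : I -> R[i]) (eta : I -> int) :
  cintegral T (fun x => \sum_(i <- r) c i * expmode (eta i) x) =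
  (2 * pi)%:C * \sum_(i <- r) c i * (eta i == 0)%:R.
Proof.
(* Explicit antiderivatives: for a nonzero frequency the primitive is periodic and its boundary
   terms cancel; for frequency 0 it is x + pi, which contributes 2 pi. *)
pose F i (x : R) : R[i] := if eta i == 0 then (x + pi)%:C
  else (0 +i* (eta i)%:~R)^-1 * expmode (eta i) x.
rewrite (@cintegral_cderiv _
    (fun x => \sum_(i <- r) c i * (0 +i* (eta i)%:~R * expmode (eta i) x))
    (fun x => \sum_(i <- r) c i * F i x)).
- rewrite -sumrB mulr_sumr; apply: eq_bigr => i _; rewrite /F.
  rewrite -mulrBr [RHS]mulrCA; congr (_ * _); case: eqP => [_|/eqP ne].
    by rewrite -rmorphB mulr1; congr (_%:C); ring.
  rewrite mulr0 -mulrBr /expmode addNr mulr0 /cis sin_2pi_int cos_2pi_int cos0 sin0.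
  by rewrite subrr mulr0.
- by move=> x; apply: cderiv_sum => i; apply: cderivZ; apply: cderiv_expmode.
- move=> x; apply: cderiv_sum => i; apply: cderivZ; rewrite /F.
  case: eqP => [->|/eqP ne]; first by rewrite expmode0; apply: cderiv_phase.
  have -> : expmode (eta i) x = (0 +i* (eta i)%:~R)^-1 * (0 +i* (eta i)%:~R * expmode (eta i) x).
    by rewrite mulKf // eq_complex /= eqxx /= intr_eq0.
  by apply: cderivZ; apply: cderiv_expmode.
Qed.

Lemma fourier_modes (I : Type) (r : seq I) (c : I -> R[i]) (eta : I -> int) xi :
  fourier (fun x => \sum_(i <- r) c i * expmode (eta i) x) xi =
  \sum_(i <- r) c i * (eta i == xi)%:R.
Proof.
rewrite /fourier.
have -> : (fun x : R => (\sum_(i <- r) c i * expmode (eta i) x) * cis (- (xi%:~R * (x + pi)))) =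
    (fun x : R => \sum_(i <- r) c i * expmode (eta i - xi) x).
  apply/funext => x; rewrite mulr_suml; apply: eq_bigr => i _.
  by rewrite expmodeD -mulrA /expmode rmorphN mulNr.
rewrite cintegral_modes mulrA -rmorphM mulVf ?mul1r; last first.
  by rewrite mulf_neq0 ?gt_eqF ?pi_gt0.
by apply: eq_bigr => i _; rewrite subr_eq0.
Qed.

End Modes.

(* The Laurent polynomial z^(-n) p(z) at z = exp (i (x + pi)). *)
Definition laurent {R : realType} (n : nat) (p : {poly R[i]}) : R -> R[i] :=
  fun x => \sum_(i < size p) p`_i * expmode (i%:Z - n%:Z) x.

Definition coef_mul {R : realType} (m : nat -> R[i]) (p : {poly R[i]}) : {poly R[i]} :=
  \poly_(i < size p) (m i * p`_i).

Section Laurent.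
Variable R : realType.
Implicit Types p q : {poly R[i]}.

Lemma coef_mulE (m : nat -> R[i]) p i : (coef_mul m p)`_i = m i * p`_i.
Proof. by rewrite coef_poly; case: ltnP => // /(nth_default 0) ->; rewrite mulr0. Qed.

Lemma size_coef_mul (m : nat -> R[i]) p : (size (coef_mul m p) <= size p)%N.
Proof. exact: size_poly. Qed.

Lemma laurent_wide n p L x : (size p <= L)%N ->
  laurent n p x = \sum_(i < L) p`_i * expmode (i%:Z - n%:Z) x.
Proof.
move=> sL; rewrite /laurent (big_ord_widen _ (fun i => p`_i * expmode (i%:Z - n%:Z) x) sL).
rewrite [RHS](bigID (fun i : 'I_L => (i < size p)%N)) /= [X in _ = _ + X]big1 ?addr0 //.
by move=> i; rewrite -leqNgt => /(nth_default 0) ->; rewrite mul0r.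
Qed.

(** With the factor z^(-n) set apart, the algebraic rules for [laurent] follow from those of
    polynomial evaluation. *)
Lemma laurentE n p x : laurent n p x = expmode (- n%:Z) x * p.[expmode 1 x].
Proof.
rewrite horner_coef mulr_sumr; apply: eq_bigr => i _.
by rewrite addrC expmodeD expmode_nat mulrCA.
Qed.

Lemma laurentM n m p q x : laurent (n + m) (p * q) x = laurent n p x * laurent m q x.
Proof.
rewrite !laurentE hornerM mulrACA -expmodeD; congr (expmode _ x * _); lia.
Qed.

Lemma laurentX n p k x : laurent (k * n) (p ^+ k) x = laurent n p x ^+ k.
Proof.
elim: k => [|k IH]; last by rewrite mulSn !exprS laurentM IH.
by rewrite laurentE mul0n !expr0 hornerE expmode0 mulr1.
Qed.

Lemma laurentD n p q x : laurent n (p + q) x = laurent n p x + laurent n q x.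
Proof. by rewrite !laurentE hornerD mulrDr. Qed.

Lemma laurentN n p x : laurent n (- p) x = - laurent n p x.
Proof. by rewrite !laurentE hornerN mulrN. Qed.

Lemma laurentZ n p c x : laurent n (c *: p) x = c * laurent n p x.
Proof. by rewrite !laurentE hornerZ mulrCA. Qed.

Lemma trig_spaceP N (u : R -> R[i]) :
  trig_space N u <-> exists2 p : {poly R[i]}, (size p <= N.+1)%N & u = laurent N./2 p.
Proof.
split=> [[c ->]|[p sp ->]].
  exists (\poly_(i < N.+1) c (inord i)); first exact: size_poly.
  apply/funext => x; rewrite (laurent_wide _ _ (size_poly _ _)).
  by apply: eq_bigr => i _; rewrite coef_poly ltn_ord inord_val.
by exists (fun i => p`_i); apply/funext => x; rewrite (laurent_wide _ _ sp).
Qed.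

Lemma fourier_laurent n p xi : fourier (laurent n p) xi =
  \sum_(i < size p) p`_i * (i%:Z - n%:Z == xi)%:R.
Proof. exact: fourier_modes. Qed.

Lemma fourier_laurent_nat n p (i : nat) : fourier (laurent n p) (i%:Z - n%:Z) = p`_i.
Proof.
rewrite fourier_laurent; have [lt|ge] := ltnP i (size p); last first.
  rewrite big1 ?nth_default // => j _; case: eqP; rewrite ?mulr0 // => e.
  by have := ltn_ord j; lia.
rewrite (bigD1 (Ordinal lt)) //= eqxx mulr1 big1 ?addr0 // => j ne.
case: eqP; rewrite ?mulr0 // => e; case/eqP: ne; apply/val_inj => /=; lia.
Qed.

Lemma laurent_inj n : injective (@laurent R n).
Proof.
by move=> p q e; apply/polyP => i; rewrite -!(fourier_laurent_nat n) e.
Qed.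

Lemma sobolev_norm_laurent gamma n p :
  sobolev_norm gamma (laurent n p) = Num.sqrt (hnorm gamma n p).
Proof.
rewrite /sobolev_norm; congr (Num.sqrt _).
pose f (xi : int) : \bar R :=
  ((1 + (xi%:~R : R) ^+ 2) `^ gamma * sqn (fourier (laurent n p) xi))%:E.
rewrite -[LHS]/(fine (\esum_(xi in [set: int]) f xi)).
have f0 xi : (0 <= f xi)%E by rewrite lee_fin mulr_ge0 ?powR_ge0 ?sqn_ge0.
pose g (i : nat) : int := i%:Z - n%:Z.
have gI : injective g by move=> i j; rewrite /g; lia.
have fE i : f (g i) = (weight gamma (g i) * sqn p`_i)%:E.
  by rewrite /f fourier_laurent_nat.
(* The Fourier coefficients vanish outside the finitely many frequencies i - n with i < [size p], so
   the series is a finite sum. *)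
have -> : \esum_(xi in [set: int]) f xi = \esum_(xi in g @` `I_(size p)) f xi.
  rewrite [RHS]esum_mkcond; apply: eq_esum => xi _; case: ifPn => // /negP nin.
  rewrite /f fourier_laurent big1 ?sqn0 ?mulr0 // => j _.
  case: eqP; rewrite ?mulr0 // => e; case: nin; rewrite inE; exists j => //=.
rewrite esum_image; last by move=> i j _ _; apply: gI.
rewrite esum_fset // -fsbig_ord.
under eq_bigr do rewrite fE.
by rewrite sumEFin.
Qed.

End Laurent.

(** * The operators as Fourier multipliers on coefficients *)

Definition dx_symbol {R : realType} (n i : nat) : R[i] := 0 +i* (i%:Z - n%:Z)%:~R.

(** With theta = eps^2 tau / 2 this is the symbol of A+, and with -theta that of A-. *)
Definition opA_symbol {R : realType} (theta : R) (n i : nat) : R[i] :=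
  1 + theta%:C * dx_symbol n i ^+ 3.

Definition shift_poly {R : realType} (L d : nat) (p : {poly R[i]}) : {poly R[i]} :=
  \poly_(j < L) p`_(j + d).

(* The k-th power of z^(-n) p(z) carries the factor z^(-kn), so P_N acts on its coefficients
   as a shift by (k - 1) n followed by truncation. *)
Definition psi_poly {R : realType} (k N : nat) (tau eps : R) (w phi : {poly R[i]}) :
    {poly R[i]} :=
  let n := N./2 in
  let theta := 2^-1 * eps ^+ 2 * tau in
  coef_mul (fun i => (opA_symbol theta n i)^-1 * opA_symbol (- theta) n i) w
  - (tau / k%:R)%:C *:
    coef_mul (fun i => (opA_symbol theta n i)^-1 * dx_symbol n i)
      (shift_poly N.+1 (k.-1 * n) ((2^-1 *: (w + phi)) ^+ k)).

Section Operators.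
Variable R : realType.
Implicit Types p q w phi : {poly R[i]}.

Lemma coef_mul_comp (m1 m2 : nat -> R[i]) p :
  coef_mul m1 (coef_mul m2 p) = coef_mul (fun i => m1 i * m2 i) p.
Proof. by apply/polyP => i; rewrite !coef_mulE mulrA. Qed.

Lemma dx_laurent n p : dx (laurent n p) = laurent n (coef_mul (dx_symbol n) p).
Proof.
apply: dx_cderiv => x; rewrite (laurent_wide _ _ (size_coef_mul _ _)).
rewrite (eq_bigr (fun i : 'I_(size p) =>
  p`_i * (dx_symbol n i * expmode (i%:Z - n%:Z) x))); last first.
  by move=> i _; rewrite coef_mulE; ring.
by apply: cderiv_sum => i; apply: cderivZ; apply: cderiv_expmode.
Qed.

Lemma iter3_dx_laurent n p :
  iter 3 dx (laurent n p) = laurent n (coef_mul (fun i => dx_symbol n i ^+ 3) p).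
Proof.
rewrite /= !dx_laurent !coef_mul_comp; congr (laurent n (coef_mul _ p)).
by apply/funext => i /=; ring.
Qed.

Lemma opAp_laurent tau eps n p : opAp tau eps (laurent n p) =
  laurent n (coef_mul (opA_symbol (2^-1 * eps ^+ 2 * tau) n) p).
Proof.
apply/funext => x; rewrite /opAp iter3_dx_laurent -laurentZ -laurentD.
congr laurent; apply/polyP => i; rewrite coefD coefZ !coef_mulE /opA_symbol.
by rewrite mulrDl mul1r mulrA.
Qed.

Lemma opAm_laurent tau eps n p : opAm tau eps (laurent n p) =
  laurent n (coef_mul (opA_symbol (- (2^-1 * eps ^+ 2 * tau)) n) p).
Proof.
apply/funext => x; rewrite /opAm iter3_dx_laurent -laurentZ -laurentN -laurentD.
congr laurent; apply/polyP => i; rewrite coefD coefN coefZ !coef_mulE /opA_symbol.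
by rewrite mulrDl mul1r rmorphN mulNr mulrA mulNr.
Qed.

(** The cube of an imaginary number is imaginary, so the real part of the symbol stays 1. The result
    is even in theta and at least 1, which gives the invertibility of A+ and the equal moduli of the
    symbols of A+ and A-. *)
Lemma sqn_opA_symbol (theta : R) n i :
  sqn (opA_symbol theta n i) = 1 + (theta * ((i%:Z - n%:Z)%:~R : R) ^+ 3) ^+ 2.
Proof.
rewrite /opA_symbol /dx_symbol; set x : R := _%:~R.
have -> : (0 +i* x) ^+ 3 = 0 +i* (- x ^+ 3).
  rewrite !exprS expr0 mulr1; apply/eqP; rewrite eq_complex /=.
  by apply/andP; split; apply/eqP; ring.
by rewrite sqnE /=; ring.
Qed.

Lemma sqn_opA_symbol_ge1 (theta : R) n i : 1 <= sqn (opA_symbol theta n i).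
Proof. by rewrite sqn_opA_symbol lerDl sqr_ge0. Qed.

Lemma opA_symbol_neq0 (theta : R) n i : opA_symbol theta n i != 0.
Proof.
by rewrite -sqn_eq0 gt_eqF // (lt_le_trans ltr01) ?sqn_opA_symbol_ge1.
Qed.

Lemma sqnV (z : R[i]) : sqn z^-1 = (sqn z)^-1.
Proof. by rewrite /sqn ComplexField.Normc.normcV exprVn. Qed.

(** The partial inverse is determined because A+ is injective on Y_N and the polynomial obtained by
    dividing by the symbol lies in Y_N and is mapped to p. *)
Lemma opAp_inv_laurent N tau eps p : (size p <= N.+1)%N ->
  opAp_inv N tau eps (laurent N./2 p) =
  laurent N./2 (coef_mul (fun i => (opA_symbol (2^-1 * eps ^+ 2 * tau) N./2 i)^-1) p).
Proof.
move=> sp; set s := opA_symbol _ _; set q := coef_mul _ _.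
have ep : coef_mul s q = p.
  by apply/polyP => i; rewrite !coef_mulE mulVKf // opA_symbol_neq0.
have -> : laurent N./2 p = opAp tau eps (laurent N./2 q) by rewrite opAp_laurent ep.
have inj : {in trig_space N &, injective (opAp tau eps)}.
  move=> u v; rewrite !inE => /trig_spaceP[pu _ ->] /trig_spaceP[pv _ ->].
  rewrite !opAp_laurent => /laurent_inj /polyP e; congr laurent; apply/polyP => i.
  by have := e i; rewrite !coef_mulE; apply: mulfI; apply: opA_symbol_neq0.
apply: (pinvKV (fun=> fun=> 0) inj).
rewrite inE; apply/trig_spaceP; exists q; last reflexivity.
by apply: leq_trans sp; apply: size_coef_mul.
Qed.

Lemma trig_proj_laurent N d p :
  trig_proj N (laurent (N./2 + d) p) = laurent N./2 (shift_poly N.+1 d p).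
Proof.
apply/funext => x; rewrite /trig_proj (laurent_wide _ _ (size_poly _ _)).
apply: eq_bigr => j _; rewrite coef_poly ltn_ord; congr (_ * _).
rewrite -(fourier_laurent_nat (N./2 + d)); congr fourier; rewrite /freq; lia.
Qed.

Lemma psi_laurent k N tau eps w phi : (0 < k)%N -> (size w <= N.+1)%N ->
  psi k N tau eps (laurent N./2 w) (laurent N./2 phi) =
  laurent N./2 (psi_poly k N tau eps w phi).
Proof.
move=> k0 sw; apply/funext => x; rewrite /psi.
have -> : (fun y => ((laurent N./2 w y + laurent N./2 phi y) / 2) ^+ k) =
    laurent (N./2 + k.-1 * N./2) ((2^-1 *: (w + phi)) ^+ k).
  (* For k > 0 the offset k n of the k-th power is n + (k - 1) n, the form on which the projection
     acts as a shift. *)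
  apply/funext => y; rewrite -mulSn prednK // laurentX laurentZ laurentD.
  by rewrite mulrC.
rewrite trig_proj_laurent opAm_laurent dx_laurent !opAp_inv_laurent.
- by rewrite -laurentZ -laurentN -laurentD !coef_mul_comp.
- exact: leq_trans (size_coef_mul _ _) (size_poly _ _).
- exact: leq_trans (size_coef_mul _ _) sw.
Qed.

Lemma size_psi_poly k N tau eps w phi : (size w <= N.+1)%N ->
  (size (psi_poly k N tau eps w phi) <= N.+1)%N.
Proof.
move=> sw; rewrite /psi_poly; apply: leq_trans (size_polyD _ _) _.
rewrite geq_max (leq_trans (size_coef_mul _ _) sw) size_polyN.
apply: leq_trans (size_scale_leq _ _) _.
exact: leq_trans (size_coef_mul _ _) (size_poly _ _).
Qed.

Lemma hnorm_shift_poly gamma n d L p :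
  hnorm gamma n (shift_poly L d p) <= hnorm gamma (n + d) p.
Proof.
rewrite (@hnorm_wide _ gamma n _ L) ?size_poly //.
(* Padding the range to d + (L + [size p]) separates the indices below, inside and above the
   retained window; the outer two sums are nonnegative and are dropped. *)
rewrite (@hnorm_wide _ gamma (n + d) p (d + (L + size p))); last by lia.
rewrite !big_split_ord /= addrCA.
rewrite (eq_bigr (fun i : 'I_L => weight gamma ((d + i)%N%:Z - (n + d)%N%:Z) * sqn p`_(d + i))).
  by rewrite lerDl addr_ge0 // sumr_ge0 // => i _; rewrite mulr_ge0 ?sqn_ge0 // ltW ?weight_gt0.
move=> i _; rewrite coef_poly ltn_ord addnC; congr (weight _ _ * _); lia.
Qed.

End Operators.

(** * Lipschitz estimates *)

Section Estimates.
Variable R : realType.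
Implicit Types p q w phi : {poly R[i]}.

(** The Cayley transform of a skew-adjoint operator is unitary. *)
Lemma sqn_cayley_symbol (theta : R) n i :
  sqn ((opA_symbol theta n i)^-1 * opA_symbol (- theta) n i) = 1.
Proof.
rewrite sqnM sqnV !sqn_opA_symbol mulNr sqrrN mulVf // gt_eqF //.
by rewrite ltr_pwDl // sqr_ge0.
Qed.

(** The inverse symbol of A+ has modulus at most 1, and the frequency i - N/2 has absolute value at
    most N. *)
Lemma sqn_dx_symbol_le (theta : R) N i : (i <= N)%N ->
  sqn ((opA_symbol theta N./2 i)^-1 * dx_symbol N./2 i) <= N%:R ^+ 2.
Proof.
move=> iN; rewrite sqnM sqnV mulrC.
apply: (@le_trans _ _ (sqn (dx_symbol N./2 i : R[i]))).
  rewrite ler_piMr ?sqn_ge0 // invf_le1 ?sqn_opA_symbol_ge1 //.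
  exact: lt_le_trans ltr01 (sqn_opA_symbol_ge1 _ _ _).
rewrite sqnE /= expr0n add0r -real_normK ?num_real //.
rewrite lerXn2r ?nnegrE // -intr_norm -[N%:R]/(N%:Z%:~R) ler_int; lia.
Qed.

(** The linear part in [w] cancels in the difference; the derivative costs a factor N, while 1 / k
    <= 1, and the projection does not increase the norm. *)
Lemma psi_poly_lipschitz gamma k N (tau eps : R) w phi1 phi2 : (0 < k)%N -> 0 <= tau ->
  hnorm gamma N./2 (psi_poly k N tau eps w phi1 - psi_poly k N tau eps w phi2) <=
  (tau * N%:R) ^+ 2 * hnorm gamma (k * N./2)
    ((2^-1 *: (w + phi1)) ^+ k - (2^-1 *: (w + phi2)) ^+ k).
Proof.
move=> k0 tau0; set A1 := _ ^+ k; set A2 := (2^-1 *: (w + phi2)) ^+ k.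
set n := N./2; set m := (k.-1 * n)%N.
rewrite (_ : (k * n = n + m)%N); last by rewrite /m -mulSn prednK.
apply: (@le_trans _ _ ((tau * N%:R) ^+ 2 * hnorm gamma n (shift_poly N.+1 m (A1 - A2)))).
  apply: hnorm_le_coef => i; rewrite /psi_poly !(coefB, coefZ, coef_mulE) -/n -/m -/A1 -/A2.
  set b := _^-1 * dx_symbol n i.
  rewrite [X in sqn X](_ : _ = - ((tau / k%:R)%:C * (b * (shift_poly N.+1 m (A1 - A2))`_i))).
    rewrite sqnN 2!sqnM sqn_real mulrA coef_poly; case: ltnP => iN; last by rewrite sqn0 !mulr0.
    rewrite ler_wpM2r ?sqn_ge0 // [leRHS]exprMn; apply: ler_pM; rewrite ?sqr_ge0 ?sqn_ge0 //.
      rewrite lerXn2r ?nnegrE ?divr_ge0 // ler_pdivrMr ?ltr0n // ler_peMr //.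
      by rewrite ler1n.
    exact: sqn_dx_symbol_le.
  rewrite !coef_poly; case: ltnP => iN; last by ring.
  by rewrite coefB; ring.
by rewrite ler_wpM2l ?sqr_ge0 // hnorm_shift_poly.
Qed.

(** At phi = -w the nonlinearity vanishes and only the unitary part remains; -w thus serves as the
    reference point for the invariance of the ball. *)
Lemma hnorm_psi_poly_opp gamma k N (tau eps : R) w : (0 < k)%N ->
  hnorm gamma N./2 (psi_poly k N tau eps w (- w)) <= hnorm gamma N./2 w.
Proof.
move=> k0; rewrite -[leRHS]mul1r; apply: hnorm_le_coef => i.
rewrite /psi_poly subrr scaler0 expr0n gtn_eqF //.
rewrite coefB coefZ !coef_mulE coef_poly coef0 if_same !mulr0 subr0.
by rewrite sqnM sqn_cayley_symbol.
Qed.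

(** The factor 1/4 from scaling meets the factor 2 of [hnormD]; hence midpoints of points of a ball
    stay in it. *)
Lemma hnorm_half gamma n w phi : hnorm gamma n (2^-1 *: (w + phi)) <=
  2^-1 * (hnorm gamma n w + hnorm gamma n phi).
Proof.
have h2 : sqn (2^-1 : R[i]) = 4^-1.
  by rewrite sqnV -[2]/(1 + 1) sqnE /= addr0 expr0n addr0; congr (_^-1); ring.
apply: le_trans (hnormZ _ _ _ _) _; rewrite h2.
have := hnormD gamma n w phi; lra.
Qed.

Lemma psi_poly_contraction gamma K a k N (tau eps : R) w phi1 phi2 :
  1 <= K -> 1 <= a -> (0 < k)%N -> 0 <= tau ->
  (forall n m p q, hnorm gamma (n + m) (p * q) <= K * (hnorm gamma n p * hnorm gamma m q)) ->
  hnorm gamma N./2 w <= a -> hnorm gamma N./2 phi1 <= a -> hnorm gamma N./2 phi2 <= a ->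
  hnorm gamma N./2 (psi_poly k N tau eps w phi1 - psi_poly k N tau eps w phi2) <=
  (tau * N%:R) ^+ 2 * (4 * K * a) ^+ k * hnorm gamma N./2 (phi1 - phi2).
Proof.
move=> K1 a1 k0 tau0 hM hw h1 h2.
apply: le_trans (psi_poly_lipschitz _ _ _ _ _ _ k0 tau0) _.
rewrite -mulrA ler_wpM2l ?sqr_ge0 //.
have hA phi : hnorm gamma N./2 phi <= a -> hnorm gamma N./2 (2^-1 *: (w + phi)) <= a.
  by move=> hphi; have := hnorm_half gamma N./2 w phi; lra.
apply: le_trans (hnorm_exp_diff k K1 a1 hM (hA _ h1) (hA _ h2)) _.
rewrite ler_wpM2l ?exprn_ge0 ?mulr_ge0 //; try lra.
(* The summand 0 lets the midpoint bound apply to the scaled difference. *)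
have -> : 2^-1 *: (w + phi1) - 2^-1 *: (w + phi2) = 2^-1 *: ((phi1 - phi2) + 0).
  by rewrite -scalerBr; congr (_ *: _); ring.
apply: le_trans (hnorm_half _ _ _ _) _.
have h0 : hnorm gamma N./2 0 = 0 by rewrite /hnorm size_poly0 big_ord0.
rewrite h0; have := hnorm_ge0 gamma N./2 (phi1 - phi2); lra.
Qed.

End Estimates.

(* tau N = tau^(1 - 1/(1+sigma0)) (tau N^(1+sigma0))^(1/(1+sigma0)). *)
Lemma step_size_bound (R : realType) (sigma0 C0 tau eps : R) (N : nat) :
  0 < sigma0 -> 0 < C0 -> 0 < tau -> (0 < N)%N ->
  tau <= C0 * Num.min (eps `^ (1 + sigma0)) (N%:R `^ (- (1 + sigma0))) ->
  tau * N%:R <= C0 `^ (1 + sigma0)^-1 * tau `^ (sigma0 / (1 + sigma0)).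
Proof.
move=> s0 C00 tau0 N0 htau; set s := 1 + sigma0.
have s_gt0 : 0 < s by rewrite /s; lra.
have NR : 0 < N%:R :> R by rewrite ltr0n.
have h : tau * N%:R `^ s <= C0.
  rewrite -ler_pdivlMr ?powR_gt0 // -powRN; apply: le_trans htau _.
  by rewrite ler_wpM2l ?ge_min ?lexx ?orbT // ltW.
have hN : tau `^ s^-1 * N%:R <= C0 `^ s^-1.
  have -> : tau `^ s^-1 * N%:R = (tau * N%:R `^ s) `^ s^-1.
    rewrite powRM ?powR_ge0 ?(ltW tau0) // -powRrM mulfV ?gt_eqF // powRr1 //.
  apply: ge0_ler_powR => //; rewrite ?nnegrE ?invr_ge0 ?mulr_ge0 ?powR_ge0 ?ltW //.
have e : tau = tau `^ s^-1 * tau `^ (sigma0 / s).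
  rewrite -powRD; last by apply/implyP => _; rewrite gt_eqF.
  rewrite -[LHS](powRr1 (ltW tau0)); congr (_ `^ _).
  by rewrite /s; field; rewrite gt_eqF.
by rewrite [X in X * N%:R]e mulrAC ler_wpM2r ?powR_ge0.
Qed.

(** * Fixed points *)

Section FixedPoint.
Variable R : realType.
Implicit Types p q : {poly R[i]}.

(** The telescoping series converges absolutely by comparison with a geometric series. *)
Lemma cvg_geometric_increments (u : R ^nat) (E : R) :
  (forall m, `|u m.+1 - u m| <= E * 2^-1 ^+ m) -> cvgn u.
Proof.
move=> hu; have E0 : 0 <= E by have := hu 0%N; rewrite expr0 mulr1; apply: le_trans.
have geo : cvgn (series (geometric E 2^-1)).
  by apply: is_cvg_geometric_series; rewrite ger0_norm ?invf_lt1 ?ltr1n.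
have cv : cvgn (series (telescope u)).
  apply: normed_cvg; apply: (series_le_cvg _ _ hu geo) => m //.
  by rewrite /= mulr_ge0 ?exprn_ge0.
have -> : u = cst (u 0%N) + series (telescope u).
  by apply/funext => m; rewrite eq_sum_telescope.
by apply: is_cvgD cv; apply: is_cvg_cst.
Qed.

(** The size bound [L] leaves finitely many coordinates, and [hnorm] is a polynomial in their real
    and imaginary parts. *)
Lemma hnorm_cvg (gamma : R) n L (P : nat -> {poly R[i]}) p q :
  (forall m, (size (P m) <= L)%N) -> (size p <= L)%N -> (size q <= L)%N ->
  (forall i, (fun m => complex.Re (P m)`_i) @ \oo --> complex.Re p`_i) ->
  (forall i, (fun m => complex.Im (P m)`_i) @ \oo --> complex.Im p`_i) ->
  (fun m => hnorm gamma n (P m - q)) @ \oo --> hnorm gamma n (p - q).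
Proof.
move=> sP sp sq cRe cIm.
have sB p1 : (size p1 <= L)%N -> (size (p1 - q)%R <= L)%N.
  by move=> s1; rewrite (leq_trans (size_polyD _ _)) // geq_max s1 size_polyN.
have E p1 : (size p1 <= L)%N -> hnorm gamma n (p1 - q) = \sum_(i < L) weight gamma (i%:Z - n%:Z) *
   ((complex.Re p1`_i - complex.Re q`_i) ^+ 2 + (complex.Im p1`_i - complex.Im q`_i) ^+ 2).
  move=> s1; rewrite (hnorm_wide _ _ (sB _ s1)); apply: eq_bigr => i _.
  by rewrite coefB sqnE; case: p1`_i; case: q`_i.
rewrite E // (_ : (fun m => _) = (fun m => \sum_(i < L) weight gamma (i%:Z - n%:Z) *
   ((complex.Re (P m)`_i - complex.Re q`_i) ^+ 2 + (complex.Im (P m)`_i - complex.Im q`_i) ^+ 2))).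
  apply: (cvg_big (x0 := 0 : R) (op := +%R)) => [|i _]; first exact: add_continuous.
  apply: cvgMl_tmp; under eq_fun do rewrite !expr2; rewrite !expr2.
  by apply: cvgD; apply: cvgM; apply: cvgB => //; apply: cvg_cst.
by apply/funext => m; rewrite E.
Qed.

(** Picard iteration from 0, with convergence coordinate by coordinate. The ratio 1/4 for squared
    norms is the contraction factor 1/2 for norms. *)
Lemma hnorm_fixpoint (gamma : R) n L (B : R) (f : {poly R[i]} -> {poly R[i]}) :
  0 <= gamma -> 0 <= B ->
  (forall p, (size p <= L)%N -> (size (f p) <= L)%N) ->
  (forall p, (size p <= L)%N -> hnorm gamma n p <= B -> hnorm gamma n (f p) <= B) ->
  (forall p q, (size p <= L)%N -> (size q <= L)%N ->
     hnorm gamma n p <= B -> hnorm gamma n q <= B ->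
     hnorm gamma n (f p - f q) <= 4^-1 * hnorm gamma n (p - q)) ->
  exists p, [/\ (size p <= L)%N, hnorm gamma n p <= B & f p = p].
Proof.
move=> g0 B0 fL fB fC; pose P m := iter m f 0.
have sP m : (size (P m) <= L)%N by elim: m => [|m IH]; rewrite ?size_poly0 //; apply: fL.
have bP m : hnorm gamma n (P m) <= B.
  elim: m => [|m IH]; last exact: fB.
  by rewrite /hnorm size_poly0 big_ord0.
pose D := hnorm gamma n (P 1%N - P 0%N).
have dP m : hnorm gamma n (P m.+1 - P m) <= 4^-1 ^+ m * D.
  elim: m => [|m IH]; first by rewrite expr0 mul1r.
  rewrite exprS -mulrA; apply: le_trans (fC _ _ (sP m.+1) (sP m) (bP m.+1) (bP m)) _.
  by rewrite ler_wpM2l.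
(* Weights are at least 1 for gamma >= 0, so every coordinate inherits the geometric decay of the
   increments. *)
have dc m i : sqn ((P m.+1)`_i - (P m)`_i) <= (Num.sqrt D * 2^-1 ^+ m) ^+ 2.
  rewrite -coefB; apply: le_trans (hnorm_coef_le n _ i g0) _; apply: le_trans (dP m) _.
  rewrite exprMn sqr_sqrtr ?hnorm_ge0 // mulrC -exprM mulnC exprM.
  by rewrite (_ : 2^-1 ^+ 2 = 4^-1 :> R) //; field.
have g m : 0 <= Num.sqrt D * 2^-1 ^+ m by rewrite mulr_ge0 ?sqrtr_ge0 ?exprn_ge0.
have cRe i : cvgn (fun m => complex.Re (P m)`_i).
  apply: (@cvg_geometric_increments _ (Num.sqrt D)) => m.
  rewrite -(@ler_pXn2r _ 2) ?nnegrE // real_normK ?num_real //.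
  apply: le_trans (dc m i); rewrite sqnE.
  by case: (P m.+1)`_i; case: (P m)`_i => a b c d /=; rewrite lerDl sqr_ge0.
have cIm i : cvgn (fun m => complex.Im (P m)`_i).
  apply: (@cvg_geometric_increments _ (Num.sqrt D)) => m.
  rewrite -(@ler_pXn2r _ 2) ?nnegrE // real_normK ?num_real //.
  apply: le_trans (dc m i); rewrite sqnE.
  by case: (P m.+1)`_i; case: (P m)`_i => a b c d /=; rewrite lerDr sqr_ge0.
pose l i : R[i] := limn (fun m => complex.Re (P m)`_i) +i* limn (fun m => complex.Im (P m)`_i).
pose p := \poly_(i < L) l i.
have sp : (size p <= L)%N by apply: size_poly.
have P0 m i : (L <= i)%N -> (P m)`_i = 0.
  by move=> Li; rewrite nth_default // (leq_trans (sP m)).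
have lRe i : (fun m => complex.Re (P m)`_i) @ \oo --> complex.Re p`_i.
  rewrite coef_poly; case: ltnP => [_|Li]; first exact: cRe.
  by under eq_fun do rewrite P0 //; apply: cvg_cst.
have lIm i : (fun m => complex.Im (P m)`_i) @ \oo --> complex.Im p`_i.
  rewrite coef_poly; case: ltnP => [_|Li]; first exact: cIm.
  by under eq_fun do rewrite P0 //; apply: cvg_cst.
have cP q (sq : (size q <= L)%N) := @hnorm_cvg gamma n L P p q sP sp sq lRe lIm.
have bp : hnorm gamma n p <= B.
  have := cP 0; rewrite size_poly0 subr0 => /(_ isT) c0.
  rewrite -(cvg_lim _ c0) //; apply: limr_le; first by apply/cvg_ex; eexists; apply: c0.
  by apply: nearW => m; rewrite subr0.
exists p; split => //; apply/eqP; rewrite -subr_eq0; apply/eqP.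
apply: (@hnorm_eq0 _ gamma n); apply/eqP; rewrite eq_le hnorm_ge0 andbT.
have c0 := cP _ sp; rewrite subrr {2}/hnorm size_poly0 big_ord0 in c0.
(* This sequence dominates the squared norm of f p - p, through the splitting into f p - f (P m) and
   P (m+1) - p, and it tends to 0. *)
have c1 : (fun m => 2 * (4^-1 * hnorm gamma n (P m - p) + hnorm gamma n (P m.+1 - p)))
    @ \oo --> (2 * (4^-1 * 0 + 0) : R).
  apply: cvgMl_tmp; apply: cvgD; first exact: cvgMl_tmp.
  by rewrite -(cvg_shiftS (fun m => hnorm gamma n (P m - p))) in c0.
rewrite mulr0 addr0 mulr0 in c1; rewrite -(cvg_lim _ c1) //.
apply: limr_ge; first by apply/cvg_ex; eexists; apply: c1.
apply: nearW => m.
have -> : f p - p = - (f (P m) - f p) + (P m.+1 - p) by rewrite -[P m.+1]/(f (P m)); ring.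
apply: le_trans (hnormD _ _ _ _) _; rewrite ler_wpM2l // lerD // hnormN.
exact: fC.
Qed.

End FixedPoint.

(** * The contraction on the ball of radius 2M and the two claims *)

Lemma sobolev_norm_laurent_le (R : realType) (gamma : R) n (p : {poly R[i]}) (r : R) : 0 <= r ->
  (sobolev_norm gamma (laurent n p) <= r) = (hnorm gamma n p <= r ^+ 2).
Proof.
move=> r0; rewrite sobolev_norm_laurent -[r in LHS]ger0_norm // -sqrtr_sqr.
by rewrite ler_sqrt ?sqr_ge0.
Qed.

Lemma psi_poly_fixpoint (R : realType) (gamma K M : R) k N (tau eps : R) (w : {poly R[i]}) :
  0 <= gamma -> 1 <= K -> 0 <= M -> (0 < k)%N -> 0 <= tau ->
  (forall n m p q, hnorm gamma (n + m) (p * q) <= K * (hnorm gamma n p * hnorm gamma m q)) ->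
  (tau * N%:R) ^+ 2 * (4 * K * (1 + 4 * M ^+ 2)) ^+ k <= 16^-1 ->
  (size w <= N.+1)%N -> hnorm gamma N./2 w <= M ^+ 2 ->
  exists p : {poly R[i]}, [/\ (size p <= N.+1)%N, hnorm gamma N./2 p <= (2 * M) ^+ 2,
    psi_poly k N tau eps w p = p &
    forall q : {poly R[i]}, hnorm gamma N./2 q <= (2 * M) ^+ 2 ->
      psi_poly k N tau eps w q = q -> q = p].
Proof.
move=> g0 K1 M0 k0 tau0 hM small sw hw.
have M20 : 0 <= M ^+ 2 by rewrite sqr_ge0.
have a1 : 1 <= 1 + 4 * M ^+ 2 by lra.
have M2 : (2 * M) ^+ 2 = 4 * M ^+ 2 by ring.
have contr p q : hnorm gamma N./2 p <= (2 * M) ^+ 2 -> hnorm gamma N./2 q <= (2 * M) ^+ 2 ->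
    hnorm gamma N./2 (psi_poly k N tau eps w p - psi_poly k N tau eps w q) <=
    16^-1 * hnorm gamma N./2 (p - q).
  rewrite M2 => hp hq; apply: le_trans (ler_wpM2r (hnorm_ge0 _ _ _) small).
  by apply: psi_poly_contraction => //; lra.
have ball p : hnorm gamma N./2 p <= (2 * M) ^+ 2 ->
    hnorm gamma N./2 (psi_poly k N tau eps w p) <= (2 * M) ^+ 2.
  (* Comparison with the image of -w gives the squared norm bound 2 (2 (4 + 1) / 16 + 1) M^2 =
     (13/4) M^2, which is below (2M)^2. *)
  move=> hp; have hNw : hnorm gamma N./2 (- w) <= (2 * M) ^+ 2 by rewrite hnormN M2; lra.
  rewrite -[psi_poly _ _ _ _ _ _](subrK (psi_poly k N tau eps w (- w))).
  apply: le_trans (hnormD _ _ _ _) _.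
  have h1 := contr _ _ hp hNw.
  have h2 := hnorm_psi_poly_opp gamma N tau eps w k0.
  have h3 := hnormD gamma N./2 p w.
  rewrite opprK in h1; move: hp; rewrite M2; lra.
have contr4 (p q : {poly R[i]}) : (size p <= N.+1)%N -> (size q <= N.+1)%N ->
    hnorm gamma N./2 p <= (2 * M) ^+ 2 -> hnorm gamma N./2 q <= (2 * M) ^+ 2 ->
    hnorm gamma N./2 (psi_poly k N tau eps w p - psi_poly k N tau eps w q) <=
    4^-1 * hnorm gamma N./2 (p - q).
  move=> _ _ hp hq; have := contr _ _ hp hq; have := hnorm_ge0 gamma N./2 (p - q); lra.
have [p [sp hp fp]] := @hnorm_fixpoint R gamma N./2 N.+1 _ (psi_poly k N tau eps w) g0
  (sqr_ge0 (2 * M)) (fun p _ => size_psi_poly k tau eps p sw) (fun p _ => ball p) contr4.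
exists p; split => // q hq fq; apply/eqP; rewrite -subr_eq0; apply/eqP.
(* For two fixed points the contraction bounds the squared distance by 1/16 of itself. *)
apply: (@hnorm_eq0 _ gamma N./2); apply/eqP; rewrite eq_le hnorm_ge0 andbT.
have := contr _ _ hq hp; rewrite fp fq; lra.
Qed.

Theorem lemma3p3 (R : realType) (sigma0 : R) (hsigma0 : 0 < sigma0) :
  exists sigma : R, 0 < sigma /\
  forall (k : nat) (gamma C0 : R),
    (2 <= k)%N -> 2^-1 < gamma -> 0 < C0 ->
    (exists C : R -> R -> R -> R,
      forall (eps tau : R) (N : nat) (w phi1 phi2 : R -> R[i]),
        0 < eps -> eps <= 1 -> 0 < tau -> (0 < N)%N -> ~~ odd N ->
        tau <= C0 * Num.min (eps `^ (1 + sigma0)) (N%:R `^ (- (1 + sigma0))) ->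
        trig_space N w -> trig_space N phi1 -> trig_space N phi2 ->
        sobolev_norm gamma
          (fun x => psi k N tau eps w phi1 x - psi k N tau eps w phi2 x) <=
        C (sobolev_norm gamma w) (sobolev_norm gamma phi1)
          (sobolev_norm gamma phi2) * tau `^ sigma *
        sobolev_norm gamma (fun x => phi1 x - phi2 x)) /\
    (forall M : R, 0 < M ->
      exists tauM : R, 0 < tauM /\
      forall (eps tau : R) (N : nat) (w : R -> R[i]),
        0 < eps -> eps <= 1 -> 0 < tau -> (0 < N)%N -> ~~ odd N ->
        tau <= C0 * Num.min (eps `^ (1 + sigma0)) (N%:R `^ (- (1 + sigma0))) ->
        trig_space N w -> sobolev_norm gamma w <= M -> tau < tauM ->
        exists! phi : R -> R[i],
          trig_ball N gamma (2 * M) phi /\ phi = psi k N tau eps w phi).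

Proof.
exists (sigma0 / (1 + sigma0)); set sigma := sigma0 / (1 + sigma0).
have sigma_gt0 : 0 < sigma by rewrite divr_gt0 // addr_gt0.
split=> // k gamma C0 k2 gamma_gt C0_gt0.
have k0 : (0 < k)%N by apply: ltnW.
have gamma_ge0 : 0 <= gamma by lra.
have [K K1 hM] := hnorm_algebra gamma_gt.
set C1 := C0 `^ (1 + sigma0)^-1.
have C1_gt0 : 0 < C1 by rewrite powR_gt0.
split.
  (* The expression 1 + x^2 + y^2 + z^2 dominates 1 and the three squared norms. The square root
     returns from squared norms to norms, and [C1] comes from the step-size condition. *)
  exists (fun x y z => C1 * Num.sqrt ((4 * K * (1 + (x ^+ 2 + y ^+ 2 + z ^+ 2))) ^+ k)).
  move=> eps tau N w phi1 phi2 eps0 eps1 tau0 N0 evenN htau.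
  move=> /trig_spaceP[pw sw ->] /trig_spaceP[p1 s1 ->] /trig_spaceP[p2 s2 ->].
  rewrite !psi_laurent // !sobolev_norm_laurent.
  rewrite (_ : (fun x => _) = laurent N./2
    (psi_poly k N tau eps pw p1 - psi_poly k N tau eps pw p2)); last first.
    by apply/funext => x; rewrite laurentD laurentN.
  rewrite (_ : (fun x => _) = laurent N./2 (p1 - p2)); last first.
    by apply/funext => x; rewrite laurentD laurentN.
  rewrite !sobolev_norm_laurent !sqr_sqrtr ?hnorm_ge0 //.
  set a := 1 + _; set h := hnorm _ _ (p1 - p2).
  have [hw h1 h2] := And3 (hnorm_ge0 gamma N./2 pw) (hnorm_ge0 gamma N./2 p1)
    (hnorm_ge0 gamma N./2 p2).
  have a1 : 1 <= a by rewrite /a; lra.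
  have Q0 : 0 <= (4 * K * a) ^+ k by rewrite exprn_ge0 // !mulr_ge0 //; lra.
  have tN0 : 0 <= tau * N%:R by rewrite mulr_ge0 // ltW.
  apply: (@le_trans _ _ (Num.sqrt ((tau * N%:R) ^+ 2 * (4 * K * a) ^+ k * h))).
    rewrite ler_sqrt ?mulr_ge0 ?sqr_ge0 ?hnorm_ge0 ?(ltW tau0) //.
    by apply: psi_poly_contraction ; rewrite ?(ltW tau0) //  /a; lra.
  rewrite sqrtrM ?(mulr_ge0 (sqr_ge0 _)) // sqrtrM ?sqr_ge0 // sqrtr_sqr ger0_norm //.
  rewrite ler_wpM2r ?sqrtr_ge0 // [leRHS]mulrAC ler_wpM2r ?sqrtr_ge0 //.
  exact: step_size_bound htau.
move=> M M0; set Q := (4 * K * (1 + 4 * M ^+ 2)) ^+ k.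
have Q1 : 1 <= Q.
  rewrite exprn_ege1 //; have M20 : 0 <= M ^+ 2 by rewrite sqr_ge0.
  have : 1 <= K * (1 + 4 * M ^+ 2) by rewrite mulr_ege1 //; lra.
  by rewrite -mulrA; lra.
have c_gt0 : 0 < (4 * C1 * Q)^-1 by rewrite invr_gt0 !mulr_gt0 //; lra.
(* Chosen so that tau^sigma <= 1 / (4 C1 Q) below it: then tau N <= 1 / (4 Q), and (tau N)^2 Q <= 1
   / (16 Q) <= 1/16. *)
exists ((4 * C1 * Q)^-1 `^ sigma^-1); split; first by rewrite powR_gt0.
move=> eps tau N w eps0 eps1 tau0 N0 evenN htau /trig_spaceP[pw sw ->].
rewrite sobolev_norm_laurent_le ?(ltW M0) // => hw tau_lt.
have small : (tau * N%:R) ^+ 2 * Q <= 16^-1.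
  have tN : tau * N%:R <= (4 * Q)^-1.
    apply: le_trans (step_size_bound hsigma0 C0_gt0 tau0 N0 htau) _.
    have -> : (4 * Q)^-1 = C1 * (4 * C1 * Q)^-1 by field; lra.
    rewrite ler_wpM2l ?(ltW C1_gt0) //.
    rewrite -[leRHS](powRr1 (ltW c_gt0)) -[X in _ <= _ `^ X](mulVf (lt0r_neq0 sigma_gt0)).
    rewrite [leRHS]powRrM.
    by apply: ge0_ler_powR; rewrite ?nnegrE ?powR_ge0 ?(ltW tau0) ?(ltW sigma_gt0) ?(ltW tau_lt).
  apply: (@le_trans _ _ ((4 * Q)^-1 ^+ 2 * Q)).
    rewrite ler_wpM2r ?lerXn2r ?nnegrE ?mulr_ge0 ?(ltW tau0) // ?invr_ge0; lra.
  rewrite [leLHS](_ : _ = 16^-1 * Q^-1); last by field; lra.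
  by rewrite ler_piMr ?invf_le1 //; lra.
have [p [sp hp fp uniq_p]] :=
  psi_poly_fixpoint eps gamma_ge0 K1 (ltW M0) k0 (ltW tau0) hM small sw hw.
have r0 : 0 <= 2 * M by lra.
exists (laurent N./2 p); split.
  split; last by rewrite psi_laurent // fp.
  by split; [apply/trig_spaceP; exists p | rewrite sobolev_norm_laurent_le].
move=> phi [[/trig_spaceP[q sq ->]]]; rewrite sobolev_norm_laurent_le // => hq.
by rewrite psi_laurent // => /laurent_inj fq; rewrite (uniq_p q).
Qed.
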